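(* For all integers $d,n$ with $d\geq 3$ and $n\geq\binom{d+2}{2}-1$ there are constants $c_4=c_4(n,d)>0$ and $c_5=c_5(n,d)>0$ with the following property. Let $A\subseteq\mathbb{R}^2$ be finite such that every subset $B\subseteq A$ with $|B|=n$ is contained in at most one curve of degree $d$. If $|A|>c_4$ and $A$ is not contained in any curve of degree $d$, then \[ \left|\mathcal{O}_{d,2n+1-\binom{d+2}{2}}(A)\right|\geq c_5|A|^{\binom{d+2}{2}-3}. \]
   Context: A curve of degree $d$ is a subset of $\mathbb{R}^2$ equal to the zero set of a polynomial in $\mathbb{R}[x,y]$ of degree exactly $d$; $\mathcal{C}_d$ denotes the family of curves of degree $d$. For $A\subseteq\mathbb{R}^2$, a curve $C_1\in\mathcal{C}_d$ is determined by $A$ if for every $C_2\in\mathcal{C}_d$ with $C_2\cap A\supseteq C_1\cap A$ we have $C_1=C_2$; $\mathcal{D}_d(A)$ is the family of curves of degree $d$ determined by $A$. For $n\in\mathbb{R}$, $\mathcal{O}_{d,n}(A):=\{C\in\mathcal{D}_d(A): |C\cap A|\le n\}$. *)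

(* Defs.v *)
From HB Require Import structures.
From mathcomp Require Import all_boot all_order all_algebra.
From mathcomp Require Import Rstruct.
From Stdlib Require Import Rdefinitions.
From mathcomp Require Import mpoly.

Set Implicit Arguments.
Unset Strict Implicit.
Unset Printing Implicit Defensive.

Import Order.TTheory GRing.Theory Num.Theory.
Local Open Scope ring_scope.

Definition point := (R * R)%type.

Definition peval (p : {mpoly R[2]}) (z : point) : R :=
  meval (fun i : 'I_2 => if val i == 0%N then z.1 else z.2) p.

Definition zero_set (p : {mpoly R[2]}) : pred point := fun z => peval p z == 0.

(* C is a curve of degree d (C \in C_d): C is the zero set of a polynomial
   of total degree exactly d (msize p = 1 + total degree). *)
Definition is_curve (d : nat) (C : pred point) : Prop :=
  exists p : {mpoly R[2]}, msize p = d.+1 /\ C =1 zero_set p.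

(* Finite sets of points are represented by duplicate-free lists. *)

Definition determined (d : nat) (A : seq point) (C1 : pred point) : Prop :=
  is_curve d C1 /\
  forall C2 : pred point, is_curve d C2 ->
    (forall z, z \in A -> C1 z -> C2 z) -> C1 =1 C2.

Definition inter_card (C : pred point) (A : seq point) : nat := count C A.

Definition in_O (d n : nat) (A : seq point) (C : pred point) : Prop :=
  determined d A C /\ (inter_card C A <= n)%nat.

Definition O_card_ge (d n : nat) (A : seq point) (m : R) : Prop :=
  exists Cs : seq (pred point),
    (forall i, (i < size Cs)%nat -> in_O d n A (nth (fun _ : point => false) Cs i)) /\
    (forall i j, (i < size Cs)%nat -> (j < size Cs)%nat -> i <> j ->
       ~ (nth (fun _ : point => false) Cs i =1 nth (fun _ : point => false) Cs j)) /\
    m <= (size Cs)%:R.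

(* Main.v *)
(* Put D = 'C(d+2, 2). Under the Veronese map, polynomials of degree at most d
   are linear forms on R^D. Multiplying by powers of 'X_0 to reach degree exactly
   d, the hypotheses say that A spans R^D and that any n points of A have rank at
   least D - 1, so a subspace of dimension at most D - 2 contains fewer than n
   points. Hence a greedy choice gives at least (|A| - n)^(D-3) independent
   (D-3)-tuples. Modulo the span of such a tuple, A becomes a spanning set of a
   3-dimensional space, i.e. a non-collinear set of the projective plane, and the
   Sylvester-Gallai theorem yields a line through exactly two projective points.
   It lifts to a hyperplane whose trace on A is covered by two subspaces of
   dimension D - 2, both containing the tuple: at most 2(n - 1) - (D - 3) points
   of A. A hyperplane with M points arises from at most M^(D-3) tuples. *)
Require Import Defs.
From HB Require Import structures.
From mathcomp Require Import all_boot all_order all_algebra.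
From mathcomp Require Import Rstruct.
From Stdlib Require Import Rdefinitions.
From mathcomp Require Import ssrnat mpoly.
From mathcomp Require Import ring lra zify.

Set Implicit Arguments.
Unset Strict Implicit.
Unset Printing Implicit Defensive.

Import Order.TTheory GRing.Theory Num.Theory.
Local Open Scope ring_scope.

(** * The Sylvester-Gallai theorem *)

Section SylvesterGallai.
Variables (F : realFieldType) (T : finType).

(** * Affine case, by Kelly's extremal argument *)

Section Affine.
Variables (P : pred T) (x y : T -> F).

Definition area2 (a b c : T) : F :=
  (x b - x a) * (y c - y a) - (y b - y a) * (x c - x a).

Definition dist2 (a b : T) : F := (x b - x a) ^+ 2 + (y b - y a) ^+ 2.

(** Different indices may carry the same point, so points are compared by coordinates. *)
Definition same_pt (a b : T) : bool := (x a == x b) && (y a == y b).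

Lemma dist2_gt0 (a b : T) : ~~ same_pt a b -> 0 < dist2 a b.
Proof.
rewrite /dist2 lt_neqAle addr_ge0 ?sqr_ge0 // andbT eq_sym.
apply: contra; rewrite paddr_eq0 ?sqr_ge0 // !sqrf_eq0 !subr_eq0 /same_pt.
by rewrite eq_sym [y b == _]eq_sym.
Qed.

Lemma area2_same_pt (a b c : T) : same_pt a b -> area2 a b c = 0.
Proof. by case/andP=> /eqP xE /eqP yE; rewrite /area2 xE yE; ring. Qed.

(* Kelly's step: [p] and [q] lie on the line [ab] on the same side of the foot
   of the perpendicular from [e], with [p] nearer to the foot. The parameters
   [s], [t], [o] are the positions of [p], [q] and the foot on the line. *)
Lemma kelly_step (a b e p q : T) (s t o : F) :
    0 < dist2 a b -> area2 a b e != 0 ->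
    x p = x a + s * (x b - x a) -> y p = y a + s * (y b - y a) ->
    x q = x a + t * (x b - x a) -> y q = y a + t * (y b - y a) ->
    o * dist2 a b =
      (x e - x a) * (x b - x a) + (y e - y a) * (y b - y a) ->
    0 <= (s - o) * (t - o) -> (s - o) ^+ 2 <= (t - o) ^+ 2 -> s != t ->
  area2 q e p != 0 /\
    area2 q e p ^+ 2 / dist2 q e < area2 a b e ^+ 2 / dist2 a b.
Proof.
move=> d_gt0 g_neq0 xp yp xq yq oE st le_st neq_st.
have areaE : area2 q e p = (t - s) * area2 a b e.
  by rewrite /area2 xp yp xq yq; ring.
(* Pythagoras, multiplied by [dist2 a b]: the leg from [e] to the foot has squared length
   [area2 a b e ^+ 2 / dist2 a b]. *)
have distE : dist2 q e * dist2 a b =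
    area2 a b e ^+ 2 + (t - o) ^+ 2 * dist2 a b ^+ 2.
  have -> : (t - o) ^+ 2 * dist2 a b ^+ 2 = (t * dist2 a b - o * dist2 a b) ^+ 2.
    by ring.
  by rewrite oE /dist2 /area2 xq yq; ring.
have g2_gt0 : 0 < area2 a b e ^+ 2 by rewrite lt_neqAle eq_sym sqrf_eq0 g_neq0 sqr_ge0.
have dq_gt0 : 0 < dist2 q e.
  rewrite -(pmulr_lgt0 _ d_gt0) distE ltr_wpDr //.
  by rewrite mulr_ge0 ?sqr_ge0.
split; first by rewrite areaE mulf_neq0 // subr_eq0 eq_sym.
rewrite areaE ltr_pdivrMr // mulrAC ltr_pdivlMr // exprMn mulrAC.
have -> : area2 a b e ^+ 2 * dist2 q e = dist2 q e * area2 a b e ^+ 2 by ring.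
rewrite ltr_pM2r //.
rewrite -(ltr_pM2r d_gt0) distE.
have le_ts : (t - s) ^+ 2 <= (t - o) ^+ 2.
  have : (s - o) ^+ 2 <= (s - o) * (t - o).
    rewrite -ler_sqr ?nnegrE ?sqr_ge0 // [leRHS]exprMn [leLHS]expr2.
    by rewrite ler_wpM2l ?sqr_ge0.
  have -> : (t - s) ^+ 2 = (t - o) ^+ 2 - (s - o) * (t - o) 
              - ((s - o) * (t - o) - (s - o) ^+ 2) by ring.
  by move=> ?; lra.
by rewrite ltr_pwDl // -mulrA -expr2 ler_wpM2r ?sqr_ge0.
Qed.

(** The parameter is that of the orthogonal projection of [c]; once denominators are cleared, each
    coordinate identity is off by a multiple of the area. *)
Lemma collinear_param (a b c : T) : 0 < dist2 a b -> area2 a b c = 0 ->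
  exists s, x c = x a + s * (x b - x a) /\ y c = y a + s * (y b - y a).
Proof.
move=> d_gt0 /eqP; rewrite subr_eq0 => /eqP areaE.
have d_neq0 : dist2 a b != 0 by rewrite gt_eqF.
exists (((x c - x a) * (x b - x a) + (y c - y a) * (y b - y a)) / dist2 a b).
split; apply: (mulIf d_neq0).
  rewrite mulrDl -!mulrA [_^-1 * _]mulrC !mulrA mulfK //.
  apply/eqP; rewrite -subr_eq0; apply/eqP; rewrite /dist2.
  transitivity (- (y b - y a) * ((x b - x a) * (y c - y a) - (y b - y a) * (x c - x a))); first by ring.
  by rewrite areaE subrr mulr0.
rewrite mulrDl -!mulrA [_^-1 * _]mulrC !mulrA mulfK //.
apply/eqP; rewrite -subr_eq0; apply/eqP; rewrite /dist2.
transitivity ((x b - x a) * ((x b - x a) * (y c - y a) - (y b - y a) * (x c - x a))); first by ring.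
by rewrite areaE subrr mulr0.
Qed.

(** If [u * v] and [v * w] are negative, then [u * w] is positive, because
    [(u * v) * (v * w) = v ^+ 2 * (u * w)]. *)
Lemma same_side (u v w : F) : u != v -> v != w -> u != w ->
  exists st : F * F, [/\ st.1 \in [:: u; v; w], st.2 \in [:: u; v; w], st.1 != st.2,
     0 <= st.1 * st.2 & st.1 ^+ 2 <= st.2 ^+ 2].
Proof.
have main p q : p != q -> 0 <= p * q -> exists st : F * F,
    [/\ st.1 \in [:: p; q], st.2 \in [:: p; q], st.1 != st.2,
     0 <= st.1 * st.2 & st.1 ^+ 2 <= st.2 ^+ 2].
  move=> pq pq0; case: (leP (p ^+ 2) (q ^+ 2)) => [le|/ltW le].
    by exists (p, q); split; rewrite //= !inE eqxx ?orbT.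
  by exists (q, p); split; rewrite //= ?inE ?eqxx ?orbT // 1?eq_sym // mulrC.
have sub p q (r : seq F) : {subset [:: p; q] <= r} -> p != q -> 0 <= p * q ->
    exists st : F * F, [/\ st.1 \in r, st.2 \in r, st.1 != st.2,
     0 <= st.1 * st.2 & st.1 ^+ 2 <= st.2 ^+ 2].
  by move=> sub /main h /h[st [/sub ? /sub ? ? ? ?]]; exists st.
move=> uv vw uw.
case: (leP 0 (u * v)) => [h|uv0].
  by apply: (sub u v) => // z; rewrite !inE => /orP[]->; rewrite ?orbT.
case: (leP 0 (v * w)) => [h|vw0].
  by apply: (sub v w) => // z; rewrite !inE => /orP[]->; rewrite ?orbT.
apply: (sub u w) => //; first by move=> z; rewrite !inE => /orP[]->; rewrite ?orbT.
have : 0 < (u * v) * (v * w) by rewrite nmulr_rgt0.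
have -> : (u * v) * (v * w) = v ^+ 2 * (u * w) by ring.
move=> h; rewrite leNgt; apply/negP => uw0.
by move: h; rewrite ltNge mulr_ge0_le0 ?sqr_ge0 ?(ltW uw0).
Qed.

(** Among non-collinear triples take one with the least height of [e] above the line [ab]. A third
    point on that line would put two of three points on one side of the foot of [e], and
    [kelly_step] would give a smaller height. *)
Lemma sylvester_gallai_affine :
    (exists a b c, [/\ P a, P b, P c & area2 a b c != 0]) ->
  exists a b, [/\ P a, P b, ~~ same_pt a b &
    forall t, P t -> area2 a b t = 0 -> same_pt t a || same_pt t b].
Proof.
case=> a0 [b0 [c0 [Pa0 Pb0 Pc0 abc0]]].
pose good (z : T * T * T) := [&& P z.1.1, P z.1.2, P z.2 & area2 z.1.1 z.1.2 z.2 != 0].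
pose h (z : T * T * T) := area2 z.1.1 z.1.2 z.2 ^+ 2 / dist2 z.1.1 z.1.2.
have good0 : good (a0, b0, c0) by rewrite /good /= Pa0 Pb0 Pc0.
case: (@Order.TotalTheory.arg_minP _ F _ (a0, b0, c0) good h good0) => -[[a b] e] /=.
rewrite {1}/good /= => /and4P[Pa Pb Pe g0] hmin.
have ab : ~~ same_pt a b by apply: contra g0 => /area2_same_pt->.
have d_gt0 := dist2_gt0 ab.
exists a, b; split=> // c Pc abc; apply: contraT; rewrite negb_or => /andP[ca cb].
have [s [xs ys]] := collinear_param d_gt0 abc.
pose o := ((x e - x a) * (x b - x a) + (y e - y a) * (y b - y a)) / dist2 a b.
have s0 : 0 != s.
  apply: contra ca => /eqP s0; rewrite /same_pt xs ys -s0 !mul0r !addr0.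
  by rewrite !eqxx.
have s1 : 1 != s.
  apply: contra cb => /eqP s1; rewrite /same_pt xs ys -s1 !mul1r.
  by rewrite ![_ + (_ - _)]addrC !subrK !eqxx.
(* The list holds the positions of [a], [b], [c] measured from the foot [o]. *)
have param r : r \in [:: 0 - o; 1 - o; s - o] -> exists p,
    [/\ P p, x p = x a + (r + o) * (x b - x a) & y p = y a + (r + o) * (y b - y a)].
  rewrite !inE => /or3P[] /eqP->.
  - by exists a; rewrite subrK !mul0r !addr0.
  - by exists b; split=> //; rewrite subrK; ring.
  - by exists c; rewrite subrK.
have [||| st [/param[p [Pp xp yp]] /param[q [Pq xq yq]] st_neq st_ge0 le_st]] :=
  @same_side (0 - o) (1 - o) (s - o).
- by rewrite (inj_eq (addIr _)) eq_sym oner_eq0.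
- by rewrite (inj_eq (addIr _)).
- by rewrite (inj_eq (addIr _)).
have [] := @kelly_step a b e p q _ _ o d_gt0 g0 xp yp xq yq.
- by rewrite /o divfK // gt_eqF.
- by rewrite !addrK.
- by rewrite !addrK.
- by rewrite (inj_eq (addIr _)).
move=> g1; rewrite ltNge.
by rewrite (hmin (q, e, p)) // /good /= Pq Pe Pp.
Qed.

End Affine.


(** * Projective case, in a three-dimensional vector space *)

Lemma poly_nonroot (p : {poly F}) : p != 0 -> exists s, p.[s] != 0.
Proof.
move=> p0; pose rs := [seq i%:R : F | i <- iota 0 (size p)].
have [/allP rsP|/allPn[s _ ps]] := boolP (all (root p) rs); last by exists s.
have := max_poly_roots p0 (introT allP rsP).
by rewrite map_inj_uniq ?iota_uniq ?size_map ?size_iota ?ltnn => [/(_ isT)|] // i j /eqP;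
  rewrite eqr_nat => /eqP.
Qed.

(** The functional is the value at [s] of the polynomial with coefficients [w t], so any non-root of
    the product of the nonzero ones works. *)
Lemma generic_functional (w : T -> 'rV[F]_3) :
  exists s, forall t, w t != 0 -> w t 0 0 + s * w t 0 1 + s ^+ 2 * w t 0 2%:R != 0.
Proof.
have [|s sP] := @poly_nonroot (\prod_(t | w t != 0) rVpoly (w t)).
  apply/prodf_neq0 => t; apply: contra => /eqP wt0.
  by rewrite -[w t]rVpolyK wt0 linear0.
exists s => t wt; move: sP; rewrite horner_prod => /prodf_neq0 /(_ t wt).
rewrite /rVpoly horner_poly !big_ord_recl big_ord0 /=.
rewrite !insubT //=.
rewrite !expr0 mulr1 addr0 expr1 addrA ![w t _ _ * _]mulrC.
by congr (w t _ _ + _ * w t _ _ + _ * w t _ _ != 0); apply/val_inj.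
Qed.

(** The line [phi = 0] misses every projective point [w t], so dividing by [phi] puts them all in
    one affine chart. Zero vectors are no points; [P] drops them. *)
Lemma sylvester_gallai (w : T -> 'rV[F]_3) :
    (forall c : 'cV[F]_3, (forall t, w t *m c = 0) -> c = 0) ->
  exists a b, [/\ w a != 0, ~~ (w b <= w a)%MS &
    forall t, (w t <= w a + w b)%MS -> (w t <= w a)%MS || (w t <= w b)%MS].
Proof.
move=> spanw; have [s sP] := generic_functional w.
pose phi t := w t 0 0 + s * w t 0 1 + s ^+ 2 * w t 0 2%:R.
pose x t := w t 0 1 / phi t; pose y t := w t 0 2%:R / phi t.
pose P : pred T := fun t => w t != 0.
have xE t : P t -> w t 0 1 = x t * phi t by move=> /sP ?; rewrite /x divfK.
have yE t : P t -> w t 0 2%:R = y t * phi t by move=> /sP ?; rewrite /y divfK.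
have zE t : P t -> w t 0 0 = phi t - s * (x t * phi t) - s ^+ 2 * (y t * phi t).
  by move=> Pt; rewrite -xE // -yE // /phi; ring.
(* [L e f g] is the affine line [e + f x + g y = 0] as a linear functional. *)
pose L e f g : 'cV[F]_3 := \col_i (if i == 0 then e else if i == 1 then s * e + f else s ^+ 2 * e + g).
have LE e f g t : P t -> w t *m L e f g = (phi t * (e + f * x t + g * y t))%:M.
  move=> Pt; apply/rowP => i; rewrite ord1 !mxE /= !big_ord_recl big_ord0 !mxE /=.
  have -> : lift ord0 ord0 = 1 :> 'I_3 by apply/val_inj.
  have -> : lift ord0 (lift ord0 ord0) = 2%:R :> 'I_3 by apply/val_inj.
  have -> : ord0 = 0 :> 'I_3 by apply/val_inj.
  by rewrite /= zE // xE // yE // mulr1n; ring.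
have L0 e f g : L e f g = 0 -> [/\ e = 0, f = 0 & g = 0].
  move=> /colP LE0; have := LE0 0; have := LE0 1; have := LE0 2%:R.
  rewrite !mxE /= => h2 h1 e0; move: h1 h2; rewrite e0 !mulr0 !add0r.
  by split.
have line e f g : (forall t, P t -> e + f * x t + g * y t = 0) -> [/\ e = 0, f = 0 & g = 0].
  move=> h; apply/L0/spanw => t; have [Pt|] := boolP (P t).
    by rewrite LE // h // mulr0 raddf0.
  by rewrite negbK => /eqP->; rewrite mul0mx.
have [] := @sylvester_gallai_affine P x y.
  case: (pickP (fun z : T * T * T => [&& P z.1.1, P z.1.2, P z.2 &
    area2 x y z.1.1 z.1.2 z.2 != 0])) => [[[a b] c] /= /and4P[]|no].
    by exists a, b, c.
  case: (pickP P) => [a Pa|P0]; last first.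
    have [] := @line 1 0 0 => [t|/eqP]; first by rewrite P0.
    by rewrite oner_eq0.
  (* If all triples are collinear, the equation of the line through [a] and [b] holds at every
     point; by [line] its coefficients vanish, which means that [b] coincides with [a]. *)
  have flat b : P b -> x b = x a /\ y b = y a.
    move=> Pb; have [|_ h1 h2] := @line ((y b - y a) * x a - (x b - x a) * y a) 
                       (- (y b - y a)) (x b - x a).
      move=> t Pt; have := no (a, b, t); rewrite /= Pa Pb Pt /= => /negbFE/eqP <-.
      by rewrite /area2; ring.
    by split; apply/eqP; rewrite -subr_eq0 ?h2 // -oppr_eq0 h1.
  have [] := @line (- x a) 1 0 => [t /flat[-> _]|_ /eqP]; first by ring.
  by rewrite oner_eq0.
move=> a [b [Pa Pb ab abP]].
have sameP c d : P c -> P d -> same_pt x y c d = (w c <= w d)%MS.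
  move=> Pc Pd; apply/idP/sub_rVP => [/andP[/eqP xcd /eqP ycd]|[l wcd]].
    have pd : phi d != 0 by apply: sP.
    exists (phi c / phi d); apply/rowP => i.
    have: i \in [:: 0; 1; 2%:R] by case: i => [[|[|[|//]]]].
    by rewrite !inE => /or3P[] /eqP->; rewrite [RHS]mxE;
      [rewrite (zE c) // (zE d) // xcd ycd | rewrite !xE // xcd | rewrite !yE // ycd]; field.
  have phiE : phi c = l * phi d by rewrite /phi wcd !mxE; ring.
  have l0 : l != 0.
    by apply: contraTneq Pc => l0; rewrite /P wcd l0 scale0r eqxx.
  by rewrite /same_pt /x /y phiE wcd !mxE -!mulf_div divff // !mul1r !eqxx.
exists a, b; split=> //; first by rewrite -sameP // /same_pt eq_sym [y b == _]eq_sym.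
move=> t /sub_addsmxP[[u v] /=]; rewrite [u]mx11_scalar [v]mx11_scalar !mul_scalar_mx.
set l := u 0 0; set m := v 0 0 => wt.
have [Pt|] := boolP (P t); last by rewrite negbK => /eqP->; rewrite sub0mx.
rewrite -!sameP //; apply: abP => //.
(* [area2 a b t] times [phi t] is linear in [w t] and vanishes at [w a] and [w b], hence at their
   combination. *)
apply: (mulIf (sP t Pt)); rewrite mul0r /area2.
change (((x b - x a) * (y t - y a) - (y b - y a) * (x t - x a)) * phi t = 0).
rewrite mulrBl -!mulrA ![(_ t - _) * _]mulrBl -xE // -yE //.
have -> : phi t = l * phi a + m * phi b by rewrite /phi wt !mxE; ring.
by rewrite wt !mxE (xE a) // (xE b) // (yE a) // (yE b) //; ring.
Qed.

End SylvesterGallai.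

(** * Hyperplanes containing few points *)

Section Span.
Variables (F : fieldType) (T : finType) (m : nat) (v : T -> 'rV[F]_m).
Implicit Types (S B : {set T}) (t : T).

Definition span S : 'M[F]_m := (\sum_(t in S) <<v t>>)%MS.

Definition flat_of p (X : 'M[F]_(p, m)) : {set T} := [set t | (v t <= X)%MS].

Lemma span_subP S p (X : 'M_(p, m)) :
  reflect {in S, forall t, (v t <= X)%MS} (span S <= X)%MS.
Proof.
by apply: (iffP sumsmx_subP) => h t /h; rewrite genmxE.
Qed.

Lemma mem_span S t : t \in S -> (v t <= span S)%MS.
Proof. by move: t; apply/span_subP. Qed.

Lemma mxrank_add_row p (X : 'M[F]_(p, m)) (u : 'rV_m) :
  ~~ (u <= X)%MS -> \rank (X + u)%MS = (\rank X).+1.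
Proof.
move=> uX; apply/eqP; rewrite eqn_leq; apply/andP; split.
  by apply: leq_trans (mxrank_adds_leqif X u) _; rewrite -[leqRHS]addn1 leq_add2l rank_leq_row.
apply: rank_ltmx; rewrite ltmxE addsmxSl; apply: contra uX.
by apply: submx_trans; apply: addsmxSr.
Qed.

Lemma span_setU1 t S : (span (t |: S) :=: span S + v t)%MS.
Proof.
apply/eqmxP/andP; split.
  apply/span_subP => z /setU1P[->|/mem_span zS]; first exact: addsmxSr.
  exact: submx_trans zS (addsmxSl _ _).
rewrite addsmx_sub mem_span ?setU11 // andbT; apply/span_subP => z zS.
by apply: mem_span; rewrite setU1r.
Qed.

Lemma mxrank_span_le S : (\rank (span S) <= #|S|)%nat.
Proof.
rewrite -sum1_card /span; elim/big_ind2: _ => [|a A b B hA hB|t tS].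
- by rewrite mxrank0.
- exact: leq_trans (mxrank_adds_leqif _ _) (leq_add hA hB).
- by rewrite genmxE rank_leq_row.
Qed.

Lemma span_flat_sub p (X : 'M_(p, m)) : (span (flat_of X) <= X)%MS.
Proof. by apply/span_subP => t; rewrite inE. Qed.

End Span.

(** * Ordinary hyperplanes and their number *)

Section Flats.
Variables (F : realFieldType) (T : finType) (k n : nat) (v : T -> 'rV[F]_k.+3).
Implicit Types (S B : {set T}) (t : T).

Hypothesis spanT : forall c : 'cV_k.+3, (forall t, v t *m c = 0) -> c = 0.
Hypothesis rank_n : forall B, #|B| = n -> (k.+2 <= \rank (span v B))%nat.

(** Any [n] points in the flat would span dimension at least [k.+2], more than [X] has. *)
Lemma small_flat p (X : 'M_(p, k.+3)) :
  (\rank X <= k.+1)%nat -> (#|flat_of v X| < n)%nat.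
Proof.
move=> rX; rewrite ltnNge; apply/negP => le_n.
pose B := [set t in take n (enum (flat_of v X))].
have cB : #|B| = n.
  rewrite cardsE (card_uniqP (take_uniq _ (enum_uniq _))) size_takel //.
  by rewrite -cardE.
have BX : (span v B <= X)%MS.
  by apply/span_subP => t; rewrite inE => /mem_take; rewrite mem_enum inE.
by have := leq_trans (rank_n cB) (leq_trans (mxrankS BX) rX); rewrite ltnn.
Qed.

(** [Q] is the quotient map modulo [X], given by a column basis of the cokernel. *)
Lemma quotient_mx (X : 'M[F]_k.+3) : \rank X = k ->
  exists Q : 'M[F]_(k.+3, 3), \rank Q = 3 /\
    forall u : 'rV_k.+3, (u <= X)%MS = (u *m Q == 0).
Proof.
move=> rX.
(* The width of [Q] is generalised to [r] because the rank of the cokernel equals 3 only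
   propositionally. *)
suff [r [-> [Q QP]]] : exists r, r = 3 /\ exists Q : 'M[F]_(k.+3, r), \rank Q = r /\
    forall u : 'rV_k.+3, (u <= X)%MS = (u *m Q == 0) by exists Q.
exists (\rank (cokermx X)); split.
  by rewrite mxrank_coker rX -addn3 addKn.
exists (col_base (cokermx X)); split.
  exact/eqP/col_base_full.
move=> u; rewrite submxE -{1}[cokermx X]mulmx_base mulmxA mulmx_free_eq0 //.
exact: row_base_free.
Qed.

(** This is [sylvester_gallai] for the images modulo [X], pulled back along the quotient map. *)
Lemma ordinary_extension (X : 'M[F]_k.+3) : \rank X = k ->
  exists a b, [/\ ~~ (v a <= X)%MS, ~~ (v b <= X + v a)%MS &
    forall t, (v t <= X + v a + v b)%MS -> (v t <= X + v a)%MS || (v t <= X + v b)%MS].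
Proof.
move=> /quotient_mx[Q [rQ QP]].
have liftP t p (Y : 'M_(p, k.+3)) : (v t *m Q <= Y *m Q)%MS -> (v t <= X + Y)%MS.
  case/submxP => C; rewrite mulmxA => /eqP; rewrite -subr_eq0 -mulmxBl -QP => h.
  rewrite -[v t](subrK (C *m Y)); apply: addmx_sub_adds => //.
  exact: submxMl.
have QX p (u : 'M_(p, k.+3)) (Y : 'M_k.+3) : (u <= X + Y)%MS -> (u *m Q <= Y *m Q)%MS.
  move=> /(submxMr Q) /submx_trans; apply.
  rewrite addsmxMr addsmx_sub submx_refl andbT.
  suff -> : X *m Q = 0 by apply: sub0mx.
  by apply/row_matrixP => i; rewrite row_mul row0; apply/eqP; rewrite -QP row_sub.
have [c wc|a [b [wa wb wab]]] := sylvester_gallai (w := fun t => v t *m Q).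
  have /spanT : forall t, v t *m (Q *m c) = 0 by move=> t; rewrite mulmxA.
  move=> Qc; apply: trmx_inj; apply/eqP; rewrite trmx0.
  have Qfree : row_free Q^T by rewrite /row_free mxrank_tr rQ.
  by rewrite -(mulmx_free_eq0 _ Qfree) -trmx_mul Qc trmx0.
exists a, b; split.
- by rewrite QP.
- apply: contra wb => h.
  have := QX _ (v b) <<v a>>%MS; rewrite !(adds_eqmx (eqmx_refl _) (genmxE _)).
  by move=> /(_ h) /submx_trans; apply; rewrite submxMr // genmxE.
- move=> t; rewrite -addsmxA => /QX h.
  have /wab : (v t *m Q <= v a *m Q + v b *m Q)%MS by rewrite -addsmxMr.
  by case/orP => /liftP ->; rewrite ?orbT.
Qed.

(** A hyperplane is encoded by its trace [S] on the points; the fixed-point condition says that [S]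
    is the whole trace. *)
Definition small_hyperplanes (M : nat) : {set {set T}} :=
  [set S : {set T} | [&& \rank (span v S) == k.+2, S == flat_of v (span v S) & (#|S| <= M)%nat]].

(** The two flats covering [S] have at most [n - 1] points each and share [B], which has at least
    [k]; and [2 * (n - 1) - k] is [2 * n + 1 - k.+3]. *)
Lemma ordinary_hyperplane B : \rank (span v B) = k ->
  exists2 S, S \in small_hyperplanes (2 * n + 1 - k.+3) & B \subset S.
Proof.
move=> rB; have [a [b [aX bX ab]]] := ordinary_extension rB.
set X := span v B in rB aX bX ab *.
pose S := flat_of v (X + v a + v b)%MS.
have BX : B \subset flat_of v X by apply/subsetP => t tB; rewrite inE mem_span.
have spanS : (span v S :=: X + v a + v b)%MS.
  apply/eqmxP; rewrite span_flat_sub /=.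
  have sub u : (v u <= X + v a + v b)%MS -> (v u <= span v S)%MS.
    by move=> h; apply: mem_span; rewrite inE.
  rewrite !addsmx_sub -andbA; apply/and3P; split.
  - apply/span_subP => t tB; apply: sub.
    by apply: submx_trans (mem_span v tB) _; rewrite -addsmxA addsmxSl.
  - by apply: sub; rewrite addsmxC addsmxA addsmxSr.
  - by apply: sub; rewrite addsmxSr.
have raX : \rank (X + v a)%MS = k.+1 by rewrite mxrank_add_row ?rB.
exists S; last first.
  apply/subsetP => t /(mem_span v) tX; rewrite inE.
  by apply: submx_trans tX _; rewrite -addsmxA addsmxSl.
rewrite inE spanS mxrank_add_row // raX eqxx /=; apply/andP; split.
  by apply/eqP/setP => t; rewrite !inE spanS.
have Xb : ~~ (v b <= X)%MS.
  by apply: contra bX => h; apply: submx_trans h (addsmxSl _ _).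
have cSa : (#|flat_of v (X + v a)%MS| < n)%nat by rewrite small_flat ?raX.
have cSb : (#|flat_of v (X + v b)%MS| < n)%nat by rewrite small_flat // mxrank_add_row ?rB.
have cB : (k <= #|B|)%nat by rewrite -rB mxrank_span_le.
have SU : S \subset flat_of v (X + v a)%MS :|: flat_of v (X + v b)%MS.
  by apply/subsetP => t; rewrite !inE; apply: ab.
have BI : B \subset flat_of v (X + v a)%MS :&: flat_of v (X + v b)%MS.
  apply/subsetP => t /(subsetP BX); rewrite !inE => h.
  by rewrite !(submx_trans h (addsmxSl _ _)).
have := subset_leq_card SU; have := subset_leq_card BI.
have := cardsUI (flat_of v (X + v a)%MS) (flat_of v (X + v b)%MS).
lia.
Qed.

Definition indep j : {set j.-tuple T} := [set s : j.-tuple T | \rank (span v [set t in s]) == j].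

Lemma card_indep j : (j <= k)%nat -> ((#|T| - n) ^ j <= #|indep j|)%nat.
Proof.
elim: j => [|j ih] jk.
  rewrite expn0 card_gt0; apply/set0Pn; exists [tuple]; rewrite inE.
  suff -> : [set t in [tuple]] = set0 :> {set T} by rewrite /span big_set0 mxrank0.
  by apply/setP => t; rewrite !inE.
have {ih} ih := ih (ltnW jk).
pose ext := [set p : T * j.-tuple T | (p.2 \in indep j) && ~~ (v p.1 <= span v [set t in p.2])%MS].
pose cons_pair (p : T * j.-tuple T) := [tuple of p.1 :: p.2].
have ext_inj : injective cons_pair.
  by move=> [x s] [y r] /= /(congr1 val) /= [-> /val_inj ->].
have extP : cons_pair @: ext \subset indep j.+1.
  apply/subsetP => _ /imsetP[[x s] + ->] /=; rewrite !inE /= => /andP[/eqP rs xs].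
  suff -> : [set t in x :: s] = x |: [set t in s] by rewrite span_setU1 mxrank_add_row ?rs.
  by apply/setP => t; rewrite !inE.
apply: leq_trans (subset_leq_card extP); rewrite (card_imset _ ext_inj).
(* Count the extensions by their tails: each independent tuple takes any point outside its span. *)
have -> : #|ext| = (\sum_(s in indep j) #|~: flat_of v (span v [set t in s])|)%nat.
  rewrite -sum1_card (eq_bigl (fun p => xpredT p.1 && ((p.1, p.2) \in ext))); last by case.
  rewrite -(pair_big_dep xpredT (fun x s => (x, s) \in ext) (fun _ _ => 1%N)) /=.
  rewrite (exchange_big_dep (mem (indep j))) /=; last first.
    by move=> x s _; rewrite inE => /andP[].
  apply: eq_bigr => s sj; rewrite -sum1_card; apply: eq_bigl => x.
  by move: sj; rewrite !inE /= => ->.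
rewrite expnSr; apply: leq_trans (leq_mul ih (leqnn _)) _.
rewrite -sum_nat_const; apply: leq_sum => s; rewrite inE => /eqP rs.
rewrite cardsCs setCK leq_sub2l // ltnW // small_flat // rs.
exact: leq_trans (ltnW jk) _.
Qed.

Lemma card_small_hyperplanes :
  ((#|T| - n) ^ k <= #|small_hyperplanes (2 * n + 1 - k.+3)| * (2 * n + 1 - k.+3) ^ k)%nat.
Proof.
set M := (_ - k.+3)%nat; set SS := small_hyperplanes M.
apply: leq_trans (card_indep (leqnn k)) _.
(* Every independent tuple lies in a small hyperplane, so a union bound over hyperplanes applies. *)
have sub : indep k \subset \bigcup_(S in SS) [set s : k.-tuple T | all (mem S) s].
  apply/subsetP => s; rewrite inE => /eqP /ordinary_hyperplane[S SSS /subsetP sS].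
  apply/bigcupP; exists S => //; rewrite inE; apply/allP => t ts.
  by apply: sS; rewrite inE.
apply: leq_trans (subset_leq_card sub) _.
rewrite -sum_nat_const.
apply: leq_trans (_ : _ <= \sum_(S in SS) #|[set s : k.-tuple T | all (mem S) s]|)%nat _.
  elim/big_rec2: _ => [|S y1 y2 _ h]; first by rewrite cards0.
  by apply: leq_trans (leq_card_setU _ _) _; rewrite leq_add2l.
apply: leq_sum => S; rewrite inE => /and3P[_ _ cS].
apply: leq_trans (_ : _ <= #|S| ^ k)%nat _; last first.
  by elim: (k) => // j ih; rewrite !expnS leq_mul.
pose f (s : k.-tuple T) := [ffun i => tnth s i].
have f_inj : injective f.
  by move=> s r /ffunP fsr; apply: eq_from_tnth => i; have := fsr i; rewrite !ffunE.
rewrite -(card_imset _ f_inj) -[in leqRHS](card_ord k) -card_ffun_on.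
apply/subset_leq_card/subsetP => _ /imsetP[s + ->]; rewrite inE => /allP sS.
by apply/ffun_onP => i; rewrite ffunE; apply/sS/mem_tnth.
Qed.

End Flats.

(** * Linear forms vanishing on a subspace *)

Section Annihilator.
Variables (F : fieldType) (m : nat).

(** Forms are columns. [nz_row] picks a nonzero form vanishing on [X] if one exists, and zero
    otherwise. *)
Definition annihilator p (X : 'M[F]_(p, m)) : 'cV[F]_m := (nz_row (kermx X^T))^T.

Lemma mul_annihilator p (X : 'M[F]_(p, m)) : X *m annihilator X = 0.
Proof.
apply: trmx_inj; rewrite trmx_mul trmxK trmx0.
by apply/sub_kermxP/nz_row_sub.
Qed.

Lemma annihilator_neq0 p (X : 'M[F]_(p, m)) : (\rank X < m)%nat -> annihilator X != 0.
Proof.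
move=> rX; rewrite /annihilator -trmx0 (inj_eq trmx_inj) nz_row_eq0.
by rewrite -mxrank_eq0 mxrank_ker mxrank_tr -lt0n subn_gt0.
Qed.

(** [X] is contained in the kernel of [c], and both have rank [m - 1]. *)
Lemma hyperplane_eq_ker p (X : 'M[F]_(p, m)) (c : 'cV[F]_m) :
  (\rank X).+1 = m -> c != 0 -> X *m c = 0 ->
  forall q (u : 'M_(q, m)), (u <= X)%MS = (u *m c == 0).
Proof.
move=> rX c0 /sub_kermxP Xc q u.
have /eqmxP XE : (X == kermx c)%MS.
  rewrite -(mxrank_leqif_eq Xc) mxrank_ker.
  have : (0 < \rank c)%nat by rewrite lt0n mxrank_eq0.
  have := rank_leq_col c; move: rX; lia.
by rewrite XE; apply/sub_kermxP/eqP.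
Qed.

(** Dually, the forms vanishing on a hyperplane make up a one-dimensional space, spanned by [c]. *)
Lemma hyperplane_annihilator p (X : 'M[F]_(p, m)) (c c' : 'cV[F]_m) :
  (\rank X).+1 = m -> c != 0 -> X *m c = 0 -> X *m c' = 0 ->
  exists a, c' = a *: c.
Proof.
move=> rX c0 Xc Xc'.
have kE (b : 'cV[F]_m) : X *m b = 0 -> (b^T <= kermx X^T)%MS.
  by move=> Xb; apply/sub_kermxP; rewrite -trmx_mul Xb trmx0.
have /eqmxP cE : (c^T == kermx X^T)%MS.
  rewrite -(mxrank_leqif_eq (kE _ Xc)) mxrank_ker !mxrank_tr.
  have : (0 < \rank c)%nat by rewrite lt0n mxrank_eq0.
  by have := rank_leq_col c; move: rX; lia.
have /sub_rVP[a ca] : (c'^T <= c^T)%MS by rewrite cE kE.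
by exists a; apply: trmx_inj; rewrite ca linearZ.
Qed.

End Annihilator.

(** * Polynomials as linear forms *)

(** Exponent vectors correspond to tuples over ['I_d.+1] with sum at most [d]. *)
Lemma card_bmultinom k d : #|{: 'X_{1..k < d.+1}}| = 'C(k + d, k).
Proof.
rewrite -card_partial_ord_partitions.
pose f (m : 'X_{1..k < d.+1}) := [tuple (inord (m i) : 'I_d.+1) | i < k].
have le_m (m : 'X_{1..k < d.+1}) i : (m i < d.+1)%nat.
  apply: leq_ltn_trans (bmdeg m); rewrite mdegE (bigD1 i) //=; exact: leq_addr.
have f_inj : injective f.
  move=> m1 m2 /(congr1 (fun t => tnth t)) eqf; apply/val_inj/mnmP => i.
  by have := congr1 (fun g => val (g i)) eqf; rewrite /f !tnth_mktuple /= !inordK.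
rewrite -(card_imset _ f_inj); congr #|pred_of_set _|; apply/setP => t.
apply/imsetP/idP => [[m _ ->]|].
  rewrite inE big_tuple.
  have -> : (\sum_(i < k) tnth (f m) i)%nat = mdeg m; last exact: (bmdeg m).
  by rewrite mdegE; apply: eq_bigr => i _; rewrite tnth_mktuple inordK.
rewrite inE big_tuple => le_t.
have lt_t : (mdeg [multinom (tnth t i : nat) | i < k] < d.+1)%nat.
  by rewrite mdegE ltnS; under eq_bigr do rewrite mnmE.
exists (BMultinom lt_t) => //; apply: eq_from_tnth => i.
by rewrite tnth_mktuple /= mnmE inord_val.
Qed.

Section Veronese.
Variables (d D : nat) (cardD : #|{: 'X_{1..2 < d.+1}}| = D).

(** [D] is tied to the number of monomials only by [cardD], so that it can later have the form
    [k.+3]. *)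
Definition monom (i : 'I_D) : 'X_{1..2} := enum_val (cast_ord (esym cardD) i).

Definition veronese (z : point) : 'rV[R]_D := \row_i peval 'X_[monom i] z.

Definition poly_of (c : 'cV[R]_D) : {mpoly R[2]} := \sum_i c i 0 *: 'X_[monom i].

Lemma veronese_mul z c : veronese z *m c = (peval (poly_of c) z)%:M.
Proof.
apply/rowP => i; rewrite ord1 !mxE /= mulr1n /peval /poly_of raddf_sum /=.
by apply: eq_bigr => j _; rewrite !mxE mevalZ mulrC.
Qed.

Lemma veronese_mul_eq0 z c : (veronese z *m c == 0) = zero_set (poly_of c) z.
Proof. by rewrite veronese_mul -scalemx1 scaler_eq0 oner_eq0 orbF. Qed.

Lemma monom_inj : injective monom.
Proof. by move=> i j /val_inj /enum_val_inj /cast_ord_inj. Qed.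

Lemma poly_of_coeff c i : (poly_of c)@_(monom i) = c i 0.
Proof.
rewrite /poly_of raddf_sum /= (bigD1 i) //= mcoeffZ mcoeffX eqxx mulr1.
rewrite big1 ?addr0 // => j ji.
by rewrite mcoeffZ mcoeffX (inj_eq monom_inj) (negPf ji) mulr0.
Qed.

Lemma poly_of_eq0 c : (poly_of c == 0) = (c == 0).
Proof.
apply/eqP/eqP => [c0|->]; last by rewrite /poly_of big1 // => i _; rewrite mxE scale0r.
by apply/colP => i; rewrite mxE -poly_of_coeff c0 mcoeff0.
Qed.

Lemma poly_ofZ a c : poly_of (a *: c) = a *: poly_of c.
Proof. by rewrite scaler_sumr; apply: eq_bigr => i _; rewrite mxE scalerA. Qed.

Lemma msize_poly_of c : (msize (poly_of c) <= d.+1)%nat.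
Proof.
apply: leq_trans (msize_sum _ _ _) _; apply/bigmax_leqP => i _.
by apply: leq_trans (msizeZ_le _ _) _; rewrite msizeX bmdeg.
Qed.

Lemma poly_of_surj p : (msize p <= d.+1)%nat -> exists c, poly_of c = p.
Proof.
move=> sp; exists (\col_i p@_(monom i)); rewrite [RHS](mpolywE sp).
rewrite (reindex (fun i => enum_val (cast_ord (esym cardD) i))) /=; last first.
  apply: onW_bij; apply: (bij_comp (@enum_val_bij _)).
  by exists (cast_ord cardD) => i; rewrite (cast_ordK, cast_ordKV).
by apply: eq_bigr => i _; rewrite mxE.
Qed.

End Veronese.

Lemma peval_mulX p j z : peval p z = 0 -> peval (p * 'X_0 ^+ j) z = 0.
Proof. by rewrite /peval mevalM => ->; rewrite mul0r. Qed.

Lemma msize_mulX (p : {mpoly R[2]}) j : p != 0 -> msize (p * 'X_0 ^+ j) = (msize p + j)%nat.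
Proof.
move=> p0.
have sX : msize ('X_0 ^+ j : {mpoly R[2]}) = j.+1.
  by rewrite mpolyXn msizeX mdegMn mdeg1 mul1n.
by rewrite msizeM ?sX ?addnS // -msize_poly_eq0 sX.
Qed.

(** * From hyperplanes to determined curves *)

Section Curves.
Variables (d n k : nat) (cardD : #|{: 'X_{1..2 < d.+1}}| = k.+3).
Variable A : seq point.

(** Curves need degree exactly [d]; a power of ['X_0] supplies the missing degree, and the zero set
    can only grow. *)
Definition pad_deg (p : {mpoly R[2]}) : {mpoly R[2]} := p * 'X_0 ^+ (d.+1 - msize p).

Lemma is_curve_pad p : p != 0 -> (msize p <= d.+1)%nat -> is_curve d (zero_set (pad_deg p)).
Proof. by move=> p0 sp; exists (pad_deg p); split=> //; rewrite msize_mulX // subnKC. Qed.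

Lemma zero_set_pad p z : zero_set p z -> zero_set (pad_deg p) z.
Proof. by move=> /eqP pz; apply/eqP/peval_mulX. Qed.

Let v (i : 'I_(size A)) : 'rV[R]_k.+3 := veronese cardD (tnth (in_tuple A) i).

Hypothesis A_uniq : uniq A.
Hypothesis A_unique_curve : forall B : seq point, uniq B -> {subset B <= A} -> size B = n ->
  forall C1 C2 : pred point, is_curve d C1 -> is_curve d C2 ->
    all C1 B -> all C2 B -> C1 =1 C2.
Hypothesis A_off_curve : forall C : pred point, is_curve d C -> ~~ all C A.

Lemma A_off_poly c : c != 0 -> exists i, ~~ zero_set (pad_deg (poly_of cardD c)) (tnth (in_tuple A) i).
Proof.
move=> c0; have := A_off_curve (is_curve_pad _ (msize_poly_of cardD c)).
rewrite poly_of_eq0 => /(_ c0) /allPn[z /(tnthP (in_tuple A))[i ->] zc].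
by exists i.
Qed.

Lemma veronese_spans (c : 'cV_k.+3) : (forall i, v i *m c = 0) -> c = 0.
Proof.
move=> vc; apply/eqP; apply: contraT => /A_off_poly[i].
by rewrite zero_set_pad // -veronese_mul_eq0 -/(v i) vc.
Qed.

(** If the rank were at most [k.+1], some form [c] would vanish on [B]. Its padded curve misses a
    point [i] of [A], yet [B] and [i] together still have rank below [k.+3], so a form [c'] vanishes
    on both. The two padded curves contain [B] and differ at [i]. *)
Lemma veronese_rank (B : {set 'I_(size A)}) : #|B| = n -> (k.+2 <= \rank (span v B))%nat.
Proof.
move=> cB; rewrite leqNgt; apply/negP => rB.
have c0 : annihilator (span v B) != 0 by rewrite annihilator_neq0 // ltnW.
have [i ci] := A_off_poly c0; set c := annihilator _ in c0 ci.
pose X := (span v B + v i)%MS.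
have c'0 : annihilator X != 0.
  apply: annihilator_neq0; rewrite (leq_ltn_trans (mxrank_adds_leqif _ _)) //.
  by have := rank_leq_row (v i); move: rB; lia.
set c' := annihilator _ in c'0.
have onB p (Y : 'M_(p, k.+3)) b j : (v j <= Y)%MS -> Y *m b = 0 ->
    zero_set (pad_deg (poly_of cardD b)) (tnth (in_tuple A) j).
  move=> /submxP[w vj] Yb; apply: zero_set_pad.
  by rewrite -veronese_mul_eq0 -/(v j) vj -mulmxA Yb mulmx0.
pose s := [seq tnth (in_tuple A) j | j <- enum B].
have eqC := A_unique_curve (B := s) _ _ _ (is_curve_pad _ (msize_poly_of cardD c))
  (is_curve_pad _ (msize_poly_of cardD c')) _ _.
have : zero_set (pad_deg (poly_of cardD c)) (tnth (in_tuple A) i).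
  rewrite eqC ?poly_of_eq0 //.
  - by apply: (onB _ X); rewrite ?mul_annihilator // addsmxSr.
  - rewrite map_inj_uniq ?enum_uniq // => x y /eqP.
    by rewrite !(tnth_nth (0, 0)) /= nth_uniq // => /eqP/val_inj.
  - by move=> _ /mapP[j _ ->]; apply: mem_tnth.
  - by rewrite size_map -cardE.
  - apply/allP => _ /mapP[j + ->]; rewrite mem_enum => jB.
    by apply: (onB _ (span v B)); rewrite ?mul_annihilator // mem_span.
  - apply/allP => _ /mapP[j + ->]; rewrite mem_enum => jB.
    apply: (onB _ X); rewrite ?mul_annihilator //.
    exact: submx_trans (mem_span v jB) (addsmxSl _ _).
by rewrite (negPf ci).
Qed.

Lemma inter_cardE (C : pred point) : inter_card C A = #|[set i | C (tnth (in_tuple A) i)]|.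
Proof.
rewrite /inter_card -sum1_count -[X in bigop _ X _]/(val (in_tuple A)) big_tuple.
by rewrite -sum1_card; apply: eq_bigl => i; rewrite inE.
Qed.

Section Hyperplane.
Variables (S : {set 'I_(size A)}).
Hypotheses (rankS : \rank (span v S) = k.+2) (flatS : S = flat_of v (span v S)).

Let c := annihilator (span v S).

Definition curve_of : pred point := zero_set (poly_of cardD c).

Let c_neq0 : c != 0.
Proof. by rewrite annihilator_neq0 // rankS. Qed.

Lemma curve_of_mem i : curve_of (tnth (in_tuple A) i) = (i \in S).
Proof.
rewrite flatS inE (hyperplane_eq_ker _ c_neq0 (mul_annihilator _)) ?rankS //.
by rewrite veronese_mul_eq0.
Qed.

Lemma vanishing_scalar c' : (forall i, i \in S -> zero_set (poly_of cardD c') (tnth (in_tuple A) i)) ->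
  exists a, c' = a *: c.
Proof.
move=> c'S; apply: (hyperplane_annihilator _ c_neq0 (mul_annihilator _)).
  by rewrite rankS.
by apply/sub_kermxP/span_subP => i /c'S; rewrite -veronese_mul_eq0 => /eqP; move/sub_kermxP.
Qed.

(* If the degree dropped below [d], then [p * 'X_0] would also vanish on [S],
   hence would be a multiple of [p]. *)
Lemma msize_curve_of : msize (poly_of cardD c) = d.+1.
Proof.
apply/eqP; rewrite eqn_leq msize_poly_of leqNgt; apply/negP => ltp.
have p0 : poly_of cardD c != 0 by rewrite poly_of_eq0.
have sX := msize_mulX 1 p0.
have [|c' c'E] := @poly_of_surj d k.+3 cardD (poly_of cardD c * 'X_0 ^+ 1).
  by rewrite sX addn1.
have [i|a c'a] := @vanishing_scalar c'.
  by rewrite -curve_of_mem c'E => /eqP h; apply/eqP/peval_mulX.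
by have := msizeZ_le (poly_of cardD c) a; rewrite -poly_ofZ -c'a c'E sX addn1 ltnn.
Qed.

(** An equation of a competing curve vanishes on [S], so it is a multiple of [poly_of cardD c]; the
    factor is nonzero because the equation has degree [d]. *)
Lemma determined_curve_of : determined d A curve_of.
Proof.
split; first by exists (poly_of cardD c); rewrite msize_curve_of.
move=> C2 [p [sp C2E]] sub z.
have [|c' c'E] := @poly_of_surj d k.+3 cardD p; first by rewrite sp.
have [i iS|a c'a] := @vanishing_scalar c'.
  by rewrite c'E -C2E; apply: sub; rewrite ?mem_tnth // curve_of_mem.
rewrite C2E /curve_of /zero_set -c'E c'a poly_ofZ /peval mevalZ mulf_eq0.
suff /negPf -> : a != 0 by [].
by apply: contra_eq_neq sp => a0; rewrite -c'E c'a poly_ofZ a0 scale0r msize0.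
Qed.

Lemma inter_card_curve_of : inter_card curve_of A = #|S|.
Proof. by rewrite inter_cardE; apply: eq_card => i; rewrite inE curve_of_mem. Qed.

End Hyperplane.

(** Distinct hyperplanes give distinct curves, since [S] is recovered as the trace of its curve on
    [A]. *)
Lemma O_card_ge_hyperplanes M (m : R) :
  m <= #|small_hyperplanes v M|%:R -> O_card_ge d M A m.
Proof.
have mem l : (l < #|small_hyperplanes v M|)%nat ->
    nth set0 (enum (small_hyperplanes v M)) l \in small_hyperplanes v M.
  by move=> lM; rewrite -mem_enum mem_nth // -cardE.
move=> mM; exists [seq curve_of X | X <- enum (small_hyperplanes v M)].
rewrite size_map -cardE; split; last split=> //.
  move=> i iM; rewrite (nth_map set0) -?cardE //.
  have := mem _ iM; rewrite inE => /and3P[/eqP rS /eqP fS cS].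
  by split; [apply: determined_curve_of | rewrite inter_card_curve_of].
move=> i j iM jM ij; rewrite !(nth_map set0) -?cardE // => eqC; apply: ij.
have := mem _ iM; have := mem _ jM; rewrite !inE.
move=> /and3P[/eqP rj /eqP fj _] /and3P[/eqP ri /eqP fi _].
apply/eqP; rewrite -(nth_uniq set0 _ _ (enum_uniq (small_hyperplanes v M))) -?cardE //.
by apply/eqP/setP => z; rewrite -!curve_of_mem.
Qed.

(** From [2 * n <= size A] follows [size A <= 2 * (size A - n)]; this factor 2 joins the tuple bound
    in the constant. *)
Lemma O_card_ge_uniform : (2 * n <= size A)%nat -> (k.+2 <= n)%nat ->
  O_card_ge d (2 * n + 1 - k.+3) A
    (((2 * (2 * n + 1 - k.+3)) ^ k)%nat%:R^-1 * (size A)%:R ^+ k).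
Proof.
move=> le_2n le_n; apply: O_card_ge_hyperplanes.
have := card_small_hyperplanes veronese_spans veronese_rank.
rewrite card_ord; set M := (_ - _.+3)%nat; set SS := small_hyperplanes _ _ => cSS.
have M_gt0 : (0 < (2 * M) ^ k)%nat by rewrite expn_gt0 muln_gt0 /M; move: le_n; lia.
rewrite RmultE mulrC ler_pdivrMr ?ltr0n // -natrX -natrM ler_nat expnMn.
rewrite mulnCA; apply: leq_trans (leq_mul (leqnn _) cSS).
rewrite -expnMn; elim: (k) => // j ih; rewrite !expnS leq_mul //.
by move: le_2n; lia.
Qed.

End Curves.

Theorem theorem7 (d n : nat) :
  (3 <= d)%nat -> ('C(d.+2, 2) - 1 <= n)%nat ->
  exists c4 c5 : R, 0 < c4 /\ 0 < c5 /\
    forall A : seq point, uniq A ->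
      (forall B : seq point, uniq B -> {subset B <= A} -> size B = n ->
         forall C1 C2 : pred point, is_curve d C1 -> is_curve d C2 ->
           all C1 B -> all C2 B -> C1 =1 C2) ->
      c4 < (size A)%:R ->
      (forall C : pred point, is_curve d C -> ~~ all C A) ->
      O_card_ge d (2 * n + 1 - 'C(d.+2, 2)) A
        (c5 * (size A)%:R ^+ ('C(d.+2, 2) - 3)).
Proof.
move=> d3 hn.
have D_ge3 : (3 <= 'C(d.+2, 2))%nat by apply: leq_trans (leq_bin2l 2 (_ : 5 <= d.+2)%nat).
(* With [D] written as [k.+3], the exponent [D - 3] is [k]. *)
have [k Dk] : exists k, 'C(d.+2, 2) = k.+3 by exists ('C(d.+2, 2) - 3)%nat; rewrite -addn3 subnK.
have cardD : #|{: 'X_{1..2 < d.+1}}| = k.+3 by rewrite card_bmultinom add2n.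
rewrite Dk subSS subn0 in hn *.
have M_gt0 : (0 < (2 * (2 * n + 1 - k.+3)) ^ k)%nat.
  by rewrite expn_gt0 muln_gt0; move: hn; lia.
(* The first constant ensures [2 * n <= size A]; the second is the factor of [O_card_ge_uniform]. *)
exists (2 * n).+1%:R, ((2 * (2 * n + 1 - k.+3)) ^ k)%nat%:R^-1.
split; first by rewrite ltr0n.
split; first by rewrite invr_gt0 ltr0n.
move=> A A_uniq A_unique; rewrite ltr_nat => sA A_off.
rewrite -addn3 addnK addn3.
by apply: O_card_ge_uniform => //; rewrite ltnW // ltnW.
Qed.
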